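(* Let $G$ be a finite group and fix a monomial order on $\mathbb{N}^n$. Let $B = \{b_1, \ldots, b_k\}$ be a standard basis of a shift-stable subgroup $I \leq G^{(\mathbb{N}^n)}$ and let $f \in G^{(\mathbb{N}^n)}$. If $f \in I$, then all reductions of $f$ by $B$ are trivial. Conversely, if any (i.e. some) reduction of $f$ by $B$ is trivial, then $f \in I$.
   Context: $\mathbb{N}$ contains $0$. $G^{(\mathbb{N}^n)}$ is the group of finitely supported maps $f\colon\mathbb{N}^n\to G$ (''tiles'') under pointwise multiplication, where $\operatorname{supp}(f)=\{\alpha\mid f(\alpha)\ne e\}$; its neutral element is the trivial tile. For $\beta\in\mathbb{N}^n$, ${}^{\beta}f(\alpha)=f(\alpha-\beta)$ if $\alpha-\beta\in\mathbb{N}^n$ and $e$ otherwise. A subgroup $I$ is shift-stable if ${}^{\beta}f\in I$ for all $f\in I$, $\beta\in\mathbb{N}^n$. $\langle S\rangle$ is the smallest shift-stable subgroup containing $S$. $S^{\pm}=S\cup\{s^{-1}\mid s\in S\}$. A monomial order on $\mathbb{N}^n$ is a total order $<$ that is a well-order and satisfies $\alpha<\beta\Rightarrow\alpha+\gamma<\beta+\gamma$. For a non-trivial tile $f$, $\operatorname{multideg}(f)=\max_<\operatorname{supp}(f)$, and $\operatorname{LT}(f)$ is the tile with value $f(\operatorname{multideg}(f))$ at $\operatorname{multideg}(f)$ and $e$ elsewhere. Conventions: the leading term of the trivial tile is the trivial tile, and its multidegree is regarded as smaller than every element of $\mathbb{N}^n$. $\operatorname{LT}(I)=\{\operatorname{LT}(f)\mid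 f\in I\}$. A finite $B\subseteq I$ is a standard basis of $I$ if $\langle\operatorname{LT}(I)\rangle=\langle\operatorname{LT}(b):b\in B\rangle$ (it is not assumed a priori that $B$ generates $I$). Reduction: a tile $r$ is a reduction of $f$ by $F$ if $f={}^{\alpha_1}f_1\cdots{}^{\alpha_m}f_m\cdot r$ for some $m\in\mathbb{N}$, $f_i\in F^{\pm}$, $\alpha_i\in\mathbb{N}^n$ such that $\operatorname{multideg}({}^{\alpha_i}f_i)\le\operatorname{multideg}(f)$ for all $i$, and $r$ is either trivial or $\operatorname{LT}(r)\notin\langle\operatorname{LT}(h):h\in F\rangle$. *)

(* Defs.v *)
From HB Require Import structures.
From mathcomp Require Import all_boot all_order all_algebra all_fingroup.
From mathcomp Require Import finmap.
From mathcomp.multinomials Require Import mpoly.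
Set Implicit Arguments.
Unset Strict Implicit.
Unset Printing Implicit Defensive.

Local Open Scope group_scope.
Local Open Scope fset_scope.

(* The exponent type is the type 'X_{1..n} of multinomials of total functions
   'I_n -> nat, with pointwise addition +%MM, pointwise truncated subtraction
   -%MM and the pointwise order <=%MM.  The degrevlex order that the library
   puts on 'X_{1..n} (in order_scope) is never used. *)
Definition tile (n : nat) (gT : finGroupType) : Type :=
  {fsfun 'X_{1..n} -> gT with 1}.

HB.instance Definition _ (n : nat) (gT : finGroupType) :=
  Choice.copy (tile n gT) {fsfun 'X_{1..n} -> gT with 1}.

Section TileGroup.
Variables (n : nat) (gT : finGroupType).
Implicit Types (f g h : tile n gT) (a b : 'X_{1..n}).

Definition tile_one : tile n gT := [fsfun with 1].

Definition tile_mul f g : tile n gT :=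
  [fsfun a in finsupp f `|` finsupp g => f a * g a].

Definition tile_inv f : tile n gT := [fsfun a in finsupp f => (f a)^-1].

Lemma tile_mulE f g a : tile_mul f g a = f a * g a.
Proof.
rewrite fsfunE in_fsetU.
by case: (finsuppP f) => Hf; case: (finsuppP g) => Hg //=; rewrite mulg1.
Qed.

Lemma tile_invE f a : tile_inv f a = (f a)^-1.
Proof. by rewrite fsfunE; case: (finsuppP f) => Hf //; rewrite invg1. Qed.

Lemma tile_oneE a : tile_one a = 1.
Proof. by rewrite fsfunE. Qed.

Lemma tile_mulA : associative tile_mul.
Proof. by move=> f g h; apply/fsfunP=> a; rewrite !tile_mulE mulgA. Qed.

Lemma tile_mul1 : left_id tile_one tile_mul.
Proof. by move=> f; apply/fsfunP=> a; rewrite tile_mulE tile_oneE mul1g. Qed.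

Lemma tile_mulr1 : right_id tile_one tile_mul.
Proof. by move=> f; apply/fsfunP=> a; rewrite tile_mulE tile_oneE mulg1. Qed.

Lemma tile_mulV : left_inverse tile_one tile_inv tile_mul.
Proof.
by move=> f; apply/fsfunP=> a; rewrite tile_mulE tile_invE tile_oneE mulVg.
Qed.

Lemma tile_mulrV : right_inverse tile_one tile_inv tile_mul.
Proof.
by move=> f; apply/fsfunP=> a; rewrite tile_mulE tile_invE tile_oneE mulgV.
Qed.

End TileGroup.

HB.instance Definition _ (n : nat) (gT : finGroupType) :=
  isGroup.Build (tile n gT) (@tile_mulA n gT) (@tile_mul1 n gT)
    (@tile_mulr1 n gT) (@tile_mulV n gT) (@tile_mulrV n gT).

Section Tiles.
Variables (n : nat) (gT : finGroupType).
Implicit Types (f g r : tile n gT) (a b : 'X_{1..n}).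
Implicit Types (S I : tile n gT -> Prop).

Lemma tileM f g a : (f * g) a = f a * g a.
Proof. exact: tile_mulE. Qed.

Lemma tile1 a : (1 : tile n gT) a = 1.
Proof. exact: tile_oneE. Qed.

Lemma tileV f a : f^-1 a = (f a)^-1.
Proof. exact: tile_invE. Qed.

Definition shift b f : tile n gT :=
  [fsfun a in [fset (c + b)%MM | c in finsupp f] =>
     if (b <= a)%MM then f (a - b)%MM else 1].

Lemma shiftE b f a : shift b f a = if (b <= a)%MM then f (a - b)%MM else 1.
Proof.
rewrite fsfunE; case: ifPn => // Ha; case: ifPn => // Hb; apply/esym/eqP.
apply: contraNT Ha => Hf; apply/imfsetP; exists (a - b)%MM => /=.
  by rewrite mem_finsupp.
by rewrite submK.
Qed.

Record is_subgroup I : Prop := IsSubgroup {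
  subgroup1 : I 1;
  subgroupM : forall f g, I f -> I g -> I (f * g);
  subgroupV : forall f, I f -> I f^-1 }.

Definition shift_stable I : Prop := forall b f, I f -> I (shift b f).

Definition shift_generated S f : Prop :=
  forall J : tile n gT -> Prop, is_subgroup J -> shift_stable J ->
    (forall g, S g -> J g) -> J f.

Definition sym_closure S f : Prop := S f \/ exists2 s, S s & f = s^-1.

End Tiles.

Record monomial_order (n : nat) (lt : rel 'X_{1..n}) : Prop := MonomialOrder {
  mo_irr : irreflexive lt;
  mo_trans : transitive lt;
  mo_total : forall a b, a != b -> lt a b || lt b a;
  mo_well : forall P : 'X_{1..n} -> Prop, (exists a, P a) ->
    exists2 a, P a & forall b, P b -> b = a \/ lt a b;
  mo_add : forall a b c, lt a b -> lt (a + c)%MM (b + c)%MM }.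

Section LeadingTerms.
Variables (n : nat) (gT : finGroupType) (lt : rel 'X_{1..n}).
Implicit Types (f g r : tile n gT) (a b : 'X_{1..n}).
Implicit Types (S I : tile n gT -> Prop).

(* None is the multidegree of the trivial tile. *)
Definition multideg f : option 'X_{1..n} :=
  omap val
    [pick a : finsupp f | [forall b : finsupp f,
       (val b == val a) || lt (val b) (val a)]].

Definition multideg_le (d e : option 'X_{1..n}) : bool :=
  match d, e with
  | None, _ => true
  | Some _, None => false
  | Some a, Some b => (a == b) || lt a b
  end.

Definition LT f : tile n gT :=
  if multideg f is Some a then [fsfun x in [fset a] => f a] else 1.

Definition LT_set S g : Prop := exists2 f, S f & g = LT f.

Definition standard_basis (B : {fset tile n gT}) I : Prop :=
  (forall h, h \in B -> I h) /\
  (forall g, shift_generated (LT_set I) g <->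
     shift_generated (LT_set (fun h => h \in B)) g).

(* The pairs in s are the (alpha_i, f_i), in order. *)
Definition is_reduction (F : tile n gT -> Prop) f r : Prop :=
  exists s : seq ('X_{1..n} * tile n gT),
    [/\ forall p, p \in s -> sym_closure F p.2,
        forall p, p \in s ->
          multideg_le (multideg (shift p.1 p.2)) (multideg f),
        f = (\prod_(p <- s) shift p.1 p.2) * r
      & r = 1 \/ ~ shift_generated (LT_set F) (LT r)].

End LeadingTerms.

(* Main.v *)
Require Import Defs.
From mathcomp Require Import all_boot all_order all_algebra all_fingroup.
From mathcomp Require Import finmap.
From mathcomp.multinomials Require Import mpoly.

(** A reduction writes [f] as a product of shifts of elements of [B] and their inverses, times [r].
    That product lies in [I], so [f] and [r] are in the same left-hand situation: [I f] iff [I r]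
    ([reduction_sub]). If [r] is trivial, then [I f]. If [I f], then [LT r] belongs to the leading
    terms of [I], hence to the shift-stable subgroup generated by those of [B], and the stopping
    condition on [r] leaves only [r = 1]. *)

Section ShiftStableSubgroup.
Variables (gT : finGroupType) (n : nat) (I : tile n gT -> Prop).
Hypotheses (I_sub : is_subgroup I) (I_shift : shift_stable I).

Lemma sym_closure_sub (S : tile n gT -> Prop) (g : tile n gT) :
  (forall h, S h -> I h) -> sym_closure S g -> I g.
Proof.
by move=> SI [/SI//|[s /SI Is ->]]; apply: subgroupV.
Qed.

Lemma prod_shift_sub (s : seq ('X_{1..n} * tile n gT)) :
  (forall p, p \in s -> I p.2) -> I (\prod_(p <- s) shift p.1 p.2)%g.
Proof.
move=> sI; rewrite big_seq; apply: (big_ind I).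
- exact: subgroup1.
- exact: subgroupM.
- by move=> p /sI; apply: I_shift.
Qed.

Lemma subgroup_mulKl (g h : tile n gT) : I g -> (I (g * h)%g <-> I h).
Proof.
move=> Ig; split=> [Igh|]; last exact: subgroupM.
by rewrite -(mulKg g h); apply: subgroupM => //; apply: subgroupV.
Qed.

(** The factor relating [f] to [r] is an element of [I], and such a factor can be cancelled in the
    subgroup [I]. *)
Lemma reduction_sub (lt : rel 'X_{1..n}) (F : tile n gT -> Prop)
    (f r : tile n gT) :
  (forall h, F h -> I h) -> is_reduction lt F f r -> (I f <-> I r).
Proof.
move=> FI [s [sF _ -> _]]; apply/subgroup_mulKl/prod_shift_sub => p /sF.
exact: sym_closure_sub.
Qed.

End ShiftStableSubgroup.

Theorem theorem3p7 (gT : finGroupType) (n : nat) (lt : rel 'X_{1..n})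
    (lt_mon : monomial_order lt) (I : tile n gT -> Prop)
    (I_sub : is_subgroup I) (I_shift : shift_stable I)
    (B : {fset tile n gT}) (B_std : standard_basis lt B I) (f : tile n gT) :
  (I f -> forall r : tile n gT,
     is_reduction lt (fun h => h \in B) f r -> r = 1%g) /\
  ((exists2 r : tile n gT,
     is_reduction lt (fun h => h \in B) f r & r = 1%g) -> I f).
Proof.
have [BI LT_eq] := B_std; split=> [If r red_r|[r red_r r1]].
  have Ir : I r by apply/(reduction_sub _ _ _ I_sub I_shift _ _ _ _ BI red_r).
  (* If [r] were not trivial, [LT r] would avoid the span of the leading terms of [B]; but [LT r] is
     a generator of the span for [I], and [LT_eq] identifies the two. *)
  have [s [_ _ _ [//|]]] := red_r; case.
  by apply/LT_eq => J _ _; apply; exists r.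
apply/(reduction_sub _ _ _ I_sub I_shift _ _ _ _ BI red_r).
by rewrite r1; apply: subgroup1.
Qed.
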